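(* Let $(\overline{x}^k)_{k\ge1}$ be generated by the inexact accelerated proximal gradient method defined in the context. Let $s^\star=\inf_{x\in\mathbb{R}^n}(f+g)(x)$, let $S^\star$ be the set of minimizers of $f+g$ over $\mathbb{R}^n$, assumed nonempty, and let $d_0$ be the distance from $x^0$ to $S^\star$. Then for every integer $k\ge1$, $$(f+g)(\overline{x}^k)-s^\star\le\frac{2Ld_0^2}{\sigma^4(1-\sigma^2)k^2}.$$
   Context: $f:\mathbb{R}^n\to\mathbb{R}$ is convex and differentiable with $\|\nabla f(x)-\nabla f(y)\|\le L\|x-y\|$ for all $x,y\in\mathbb{R}^n$, for some $L>0$; $g:\mathbb{R}^n\to\,]-\infty,\infty]$ is proper closed convex. For $\epsilon\ge0$, $\partial_\epsilon g(x)=\{v: g(x')\ge g(x)+\langle v,x'-x\rangle-\epsilon\ \ \forall x'\in\mathbb{R}^n\}$. Inexact accelerated proximal gradient method: choose $x^0,\overline{x}^0\in\mathbb{R}^n$ and $\sigma\ge 0$ with $\sigma^2\in(0,1/2)$; set $t_0=0$, $\alpha=\sigma^2/L$. For $k=1,2,\dots$: (1) $\beta_k=\dfrac{\alpha(1-\sigma^2)+\sqrt{\alpha^2(1-\sigma^2)^2+4\alpha(1-\sigma^2)t_{k-1}}}{2}$, $t_k=t_{k-1}+\beta_k$, $\tilde{x}^k=\dfrac{t_{k-1}}{t_k}\overline{x}^{k-1}+\dfrac{\beta_k}{t_k}x^{k-1}$, $y^k=\tilde{x}^k-\alpha\nabla f(\tilde{x}^k)$; (2) compute $(\overline{x}^k,\overline{w}^k,\overline{\epsilon}_k)\in\mathbb{R}^n\times\mathbb{R}^n\times[0,\infty)$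 with $\overline{w}^k\in\partial_{\overline{\epsilon}_k}g(\overline{x}^k)$ and $$\|\alpha\overline{w}^k+\overline{x}^k-y^k\|^2+2\alpha\overline{\epsilon}_k\le\sigma^2\big(\|\overline{x}^k-\tilde{x}^k\|^2+\|\alpha(\overline{w}^k+\nabla f(\tilde{x}^k))\|^2\big);$$ (3) $x^k=x^{k-1}-\beta_k(\nabla f(\tilde{x}^k)+\overline{w}^k)$. *)

(* Defs.v *)
From HB Require Import structures.
From mathcomp Require Export all_boot all_order all_algebra.
From mathcomp Require Export all_classical all_reals all_analysis.
Import Order.TTheory GRing.Theory Num.Theory.
Export numFieldNormedType.Exports.

Set Implicit Arguments.
Unset Strict Implicit.
Unset Printing Implicit Defensive.

Local Open Scope classical_set_scope.
Local Open Scope ring_scope.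

(* The canonical norm `|u| on 'rV[R]_n is the sup norm, hence the separate
   Euclidean structure below; differentiability and closedness are taken in
   the library's topology on 'rV[R]_n, which is the usual one. *)
Definition dotv (R : realType) (n : nat) (u v : 'rV[R]_n) : R :=
  (u *m v^T) 0 0.

Definition enorm (R : realType) (n : nat) (u : 'rV[R]_n) : R :=
  Num.sqrt (dotv u u).

Definition edist_set (R : realType) (n : nat) (x : 'rV[R]_n)
    (S : set 'rV[R]_n) : R :=
  inf [set enorm (x - z) | z in S].

Definition grad (R : realType) (n : nat) (f : 'rV[R]_n -> R) (x : 'rV[R]_n) :
  'rV[R]_n := \row_(i < n) 'D_(delta_mx 0 i) f x.

Definition epigraph (R : realType) (n : nat) (g : 'rV[R]_n -> \bar R) :
  set ('rV[R]_n * R^o)%type := [set p | (g p.1 <= p.2%:E)%E].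

Definition proper_closed_convex (R : realType) (n : nat)
    (g : 'rV[R]_n -> \bar R) : Prop :=
  [/\ (forall x, g x != -oo%E) /\ (exists x, g x != +oo%E),
      closed (epigraph g)
    & convex_set (epigraph g)].

Definition eps_subdiff (R : realType) (n : nat) (g : 'rV[R]_n -> \bar R)
    (eps : R) (x : 'rV[R]_n) : set 'rV[R]_n :=
  [set v | forall x', (g x + (dotv v (x' - x))%:E - eps%:E <= g x')%E].

Definition csum (R : realType) (n : nat) (f : 'rV[R]_n -> R)
    (g : 'rV[R]_n -> \bar R) (x : 'rV[R]_n) : \bar R :=
  ((f x)%:E + g x)%E.

Definition minimizers (R : realType) (n : nat) (F : 'rV[R]_n -> \bar R) :
  set 'rV[R]_n := [set x | forall y, (F x <= F y)%E].

(* beta_k as a function of t_{k-1} *)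
Definition apg_beta (R : realType) (alpha sigma t : R) : R :=
  (alpha * (1 - sigma ^+ 2)
   + Num.sqrt (alpha ^+ 2 * (1 - sigma ^+ 2) ^+ 2
               + 4 * alpha * (1 - sigma ^+ 2) * t)) / 2.

Fixpoint apg_t (R : realType) (alpha sigma : R) (k : nat) : R :=
  if k is j.+1 then
    apg_t alpha sigma j + apg_beta alpha sigma (apg_t alpha sigma j)
  else 0.

(* The sequences x, xbar, w, eps form a run of the method.  The method is
   nondeterministic in (xbar, w, eps), so a run is a relation; the body
   describes iteration j + 1.  The values w 0 and eps 0 are not used. *)
Definition inexact_apg (R : realType) (n : nat) (f : 'rV[R]_n -> R)
    (g : 'rV[R]_n -> \bar R) (L sigma : R)
    (x xbar w : nat -> 'rV[R]_n) (eps : nat -> R) : Prop :=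
  let alpha := sigma ^+ 2 / L in
  let t := apg_t alpha sigma in
  forall j : nat,
    let beta := apg_beta alpha sigma (t j) in
    let xtilde := (t j / t j.+1) *: xbar j + (beta / t j.+1) *: x j in
    let y := xtilde - alpha *: grad f xtilde in
    [/\ 0 <= eps j.+1,
        eps_subdiff g (eps j.+1) (xbar j.+1) (w j.+1),
        enorm (alpha *: w j.+1 + xbar j.+1 - y) ^+ 2 + 2 * alpha * eps j.+1
          <= sigma ^+ 2 * (enorm (xbar j.+1 - xtilde) ^+ 2
               + enorm (alpha *: (w j.+1 + grad f xtilde)) ^+ 2)
      & x j.+1 = x j - beta *: (grad f xtilde + w j.+1)].

(* Main.v *)
Require Import Defs.
From mathcomp Require Import ring lra.
Import Order.TTheory GRing.Theory Num.Theory.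

(** Write [F = f + g], [a = sigma^2 / L], and at step [k] let [y] be the
    extrapolated point [xtilde], [v = grad f y + w k] and [X = xbar k].

    The vector [v] is an approximate subgradient of [F] at [X]: convexity bounds
    [f] below by its linearization at [y], the Lipschitz gradient bounds [f X]
    above by the same linearization plus [L / 2 |X - y|^2], and [w k] is an
    approximate subgradient of [g].  The total error is
    [e = eps k + L / 2 |X - y|^2] ([eps_subdiff_csum]).  Since
    [a L = sigma^2 <= 1/2], the relative error test absorbs this extra quadratic
    term and says that the affine minorant of [F] given by [v] has at [y] a
    value exceeding [F X] by at least [a (1 - sigma^2) / 2 |v|^2]
    ([inexact_prox_criterion]).

    The point [y] is the mean of [xbar (k-1)] and [x (k-1)] with weights
    [t (k-1)] and [beta k].  Evaluating the minorant at [xbar (k-1)] and at a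
    reference point [z] with these weights, the gain at [y] compensates exactly
    the term [beta^2 |v|^2 / 2] produced by the step from [x (k-1)] to [x k],
    because [beta] solves [beta^2 = a (1 - sigma^2) t k].  Hence the potential
    [t k (F (xbar k) - F z) + |x k - z|^2 / 2] never increases
    ([accelerated_step], [apg_potential]).

    As [t 0 = 0], this gives [2 t k (F (xbar k) - F z) <= |x 0 - z|^2] for every
    minimizer [z], and passing to the infimum over [z] replaces the right-hand
    side by [d0^2].  The recursion makes the square root of [t k] grow at least
    linearly, so that [t k >= a (1 - sigma^2) k^2 / 4] ([apg_t_ge]). *)
Set Implicit Arguments.
Unset Strict Implicit.
Unset Printing Implicit Defensive.

Local Open Scope classical_set_scope.
Local Open Scope ring_scope.

(** * The Euclidean inner product *)

Section Euclidean.
Context {R : realType} {n : nat}.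
Implicit Types (a c : R) (u v w : 'rV[R]_n).

Lemma dotvE u v : dotv u v = \sum_i u 0 i * v 0 i.
Proof. by rewrite /dotv mxE; apply: eq_bigr => i _; rewrite mxE. Qed.

Lemma dotvC u v : dotv u v = dotv v u.
Proof. by rewrite !dotvE; apply: eq_bigr => i _; rewrite mulrC. Qed.

Lemma dotvDl u v w : dotv (u + v) w = dotv u w + dotv v w.
Proof. by rewrite /dotv mulmxDl mxE. Qed.

Lemma dotvZl a u v : dotv (a *: u) v = a * dotv u v.
Proof. by rewrite /dotv -scalemxAl mxE. Qed.

Lemma dotvNl u v : dotv (- u) v = - dotv u v.
Proof. by rewrite -scaleN1r dotvZl mulN1r. Qed.

Lemma dotvDr u v w : dotv u (v + w) = dotv u v + dotv u w.
Proof. by rewrite dotvC dotvDl !(dotvC u). Qed.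

Lemma dotvZr a u v : dotv u (a *: v) = a * dotv u v.
Proof. by rewrite dotvC dotvZl (dotvC u). Qed.

Lemma dotvNr u v : dotv u (- v) = - dotv u v.
Proof. by rewrite dotvC dotvNl (dotvC u). Qed.

Definition dotv_expand := (dotvDl, dotvDr, dotvZl, dotvZr, dotvNl, dotvNr).

Lemma dotv_ge0 u : 0 <= dotv u u.
Proof. by rewrite dotvE sumr_ge0// => i _; rewrite -expr2 sqr_ge0. Qed.

Lemma sqr_enorm u : enorm u ^+ 2 = dotv u u.
Proof. by rewrite sqr_sqrtr ?dotv_ge0. Qed.

Lemma enormZ a u : enorm (a *: u) = `|a| * enorm u.
Proof.
rewrite /enorm dotvZl dotvZr mulrA -expr2 sqrtrM ?sqr_ge0//.
by rewrite sqrtr_sqr.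
Qed.

(** Expanding [0 <= |u - c v|^2] bounds [2 c <u, v>] by [|u|^2 + c^2 |v|^2],
    which gives the consequence of Cauchy-Schwarz that a Lipschitz gradient
    calls for. *)
Lemma dotv_le_sqr_enorm c u v :
  0 < c -> enorm u <= c * enorm v -> dotv u v <= c * enorm v ^+ 2.
Proof.
move=> c0 uv.
have uv2 : dotv u u <= c ^+ 2 * dotv v v.
  by rewrite -!sqr_enorm -exprMn lerXn2r ?nnegrE ?mulr_ge0 ?sqrtr_ge0 ?(ltW c0).
have := dotv_ge0 (u - c *: v).
rewrite !dotv_expand (dotvC v u) => h.
rewrite -(ler_pM2l c0) sqr_enorm; nra.
Qed.

End Euclidean.

(** * Smooth convex functions *)

Section Smooth.
Context {R : realType} {n : nat}.
Implicit Types (f : 'rV[R]_n -> R) (x y z h : 'rV[R]_n).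

Lemma derive_grad f x h : differentiable f x -> 'D_h f x = dotv (grad f x) h.
Proof.
move=> df; rewrite deriveE// dotvE [in LHS](row_sum_delta h) linear_sum/=.
by apply: eq_bigr => i _; rewrite linearZ/= mxE deriveE// mulrC.
Qed.

Lemma is_derive_line f x h (t : R) : differentiable f (x + t *: h) ->
  is_derive t 1 (fun s => f (x + s *: h)) (dotv (grad f (x + t *: h)) h).
Proof.
move=> df; rewrite -derive_grad//.
have dl : is_diff t (fun s : R => x + s *: h) (fun s : R => s *: h).
  have dD := is_diffD (is_diff_cst x t) (is_diff_scalel t h).
  by apply: is_diff_eq dD _; apply/funext => s; rewrite /= add0r.
have dc : is_diff t (f \o (fun s : R => x + s *: h))
    ('d f (x + t *: h) \o (fun s : R => s *: h)).
  by apply: is_diff_comp; exact: DiffDef.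
have dfl : differentiable (f \o (fun s : R => x + s *: h)) t by case: dc.
apply: DeriveDef; first exact: diff_derivable.
by rewrite [LHS]deriveE// [in RHS]deriveE// diff_val/= scale1r.
Qed.

(** Along the segment from [x] to [x + h], the derivative of [f] exceeds its
    initial value [<grad f x, h>] by at most [L t |h|^2]; subtracting
    [t <grad f x, h> + L t^2 |h|^2 / 2] thus leaves a nonincreasing function. *)
Lemma descent_lemma f (L : R) x h : 0 < L ->
  (forall z, differentiable f z) ->
  (forall y z, enorm (grad f y - grad f z) <= L * enorm (y - z)) ->
  f (x + h) <= f x + dotv (grad f x) h + L / 2 * enorm h ^+ 2.
Proof.
move=> L0 df lip.
pose phi (t : R) := f (x + t *: h)
  - (dotv (grad f x) h * t + L / 2 * enorm h ^+ 2 * t ^+ 2).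
pose dphi (t : R) := dotv (grad f (x + t *: h)) h
  - (dotv (grad f x) h + L * enorm h ^+ 2 * t).
have dphiE (t : R) : is_derive t 1 phi (dphi t).
  have dl := is_derive_line (df (x + t *: h)).
  apply: is_derive_eq.
  rewrite /dphi; congr (_ - _); by rewrite /GRing.scale/=; field.
have phi_cont : {within `[0, 1], continuous phi}.
  by apply: derivable_within_continuous => t _; exact: ex_derive.
have [t /[!in_itv]/= /andP[t0 _] phiE] := MVT ltr01 (fun s _ => dphiE s) phi_cont.
have dphi_le0 : dphi t <= 0.
  have := @dotv_le_sqr_enorm _ _ (L * t) (grad f (x + t *: h) - grad f x) h.
  rewrite mulr_gt0// => /(_ isT); rewrite dotvDl dotvNl /dphi => bound.
  suff : enorm (grad f (x + t *: h) - grad f x) <= L * t * enorm h.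
    by move=> /bound; lra.
  apply: le_trans (lip _ _) _.
  by rewrite addrAC subrr add0r enormZ gtr0_norm// mulrA.
move: phiE; rewrite /phi scale0r scale1r addr0; lra.
Qed.

(** Difference quotients of a convex function at [x] towards [z] are bounded
    above by the full increment [f z - f x]; so is their limit. *)
Lemma convex_gradient_inequality f x z :
  convex_function setT f -> differentiable f x ->
  f x + dotv (grad f x) (z - x) <= f z.
Proof.
move=> cf df; rewrite -derive_grad// addrC -lerBrDr.
have dq := @diff_derivable _ _ _ _ _ (z - x) df.
have cq := cvg_dnbhs_at_right dq.
rewrite (_ : 'D_(z - x) f x =
  lim ((fun t => t^-1 *: (f (t *: (z - x) + x) - f x)) @ 0^'+)); last first.
  by rewrite /derive; exact: cvg_at_rightE.
apply: limr_le; first by apply/cvg_ex; eexists; exact: cq.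
near=> t.
have t0 : 0 < t by [].
have t1 : t <= 1 by near: t; exact: nbhs_right_le.
rewrite /GRing.scale/= mulrC ler_pdivrMr//.
pose p : {i01 R} := Itv01 (ltW t0) t1.
have := cf p z x; rewrite !in_setT => /(_ isT isT).
rewrite convRE [X in f X](_ : _ = t *: (z - x) + x).
  by rewrite /= /unstable.onem; lra.
by rewrite /conv/= /unstable.onem scalerBl scalerBr scale1r addrA addrAC.
Unshelve. all: by end_near. Qed.

End Smooth.

(** * One inexact accelerated step *)

Section Inexact.
Context {R : realType} {n : nat}.
Implicit Types (f : 'rV[R]_n -> R) (g F : 'rV[R]_n -> \bar R).

Lemma eps_subdiff_fin_num F (e : R) x v z :
  eps_subdiff F e x v -> (F x != -oo)%E -> (F z < +oo)%E -> F x \is a fin_num.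
Proof.
move=> /(_ z); case: (F x) => [r| |]//= + _.
by case: (F z).
Qed.

(** The point [y] where [f] is linearized differs from the point [x] where the
    subgradient of [g] is taken; the price is the gap of the descent lemma
    between [y] and [x], which joins the error [e]. *)
Lemma eps_subdiff_csum f g (L e : R) y x v : 0 < L ->
  (forall z, differentiable f z) ->
  (forall y z, enorm (grad f y - grad f z) <= L * enorm (y - z)) ->
  convex_function setT f -> (g x != -oo)%E ->
  eps_subdiff g e x v ->
  eps_subdiff (csum f g) (e + L / 2 * enorm (x - y) ^+ 2) x (grad f y + v).
Proof.
move=> L0 df lip cf gx sub z; have := sub z.
have := descent_lemma y (x - y) L0 df lip.
have := convex_gradient_inequality z cf (df y).
rewrite (addrC y) subrK /csum.
rewrite -[z - y](subrKA x) !dotv_expand => cvx smooth.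
case: (g x) gx => [r| |] // _; last by case: (g z).
case: (g z) => [r'| |]//=; rewrite ?leey// -?EFinD ?lee_fin; lra.
Qed.

(** With [v = G + w] and [d = x - y], expanding [|a v + d|^2] in the error test
    leaves [2 a <v, d> + 2 a e <= - a^2 (1 - s) |v|^2 - (1 - s) |d|^2].  The
    term [a L |d|^2 = s |d|^2] still has to be added on the left, and
    [s <= 1 - s] makes room for it. *)
Lemma inexact_prox_criterion (a L s e : R) (G w x y : 'rV[R]_n) :
  0 < a -> a * L = s -> s <= 1 / 2 ->
  enorm (a *: w + x - (y - a *: G)) ^+ 2 + 2 * a * e
    <= s * (enorm (x - y) ^+ 2 + enorm (a *: (w + G)) ^+ 2) ->
  dotv (G + w) (x - y) + (e + L / 2 * enorm (x - y) ^+ 2)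
    <= - (a * (1 - s) / 2 * dotv (G + w) (G + w)).
Proof.
move=> a0 aL s2.
rewrite (_ : a *: w + x - _ = a *: (G + w) + (x - y)); last first.
  by rewrite opprB addrACA -scalerDr (addrC w).
rewrite (addrC w G); move: (G + w) (x - y) => v d.
rewrite !sqr_enorm !dotv_expand (dotvC d v) -aL => crit.
have aL2 : 0 <= 1 / 2 - a * L by rewrite subr_ge0 aL.
have := mulr_ge0 aL2 (dotv_ge0 d) => d0.
rewrite -(ler_pM2l a0); lra.
Qed.

(** Here [xp], [zp] are the previous iterates and [x], [zp - b v] the new ones;
    [Fp], [Fx], [Fz] are the values of the objective at [xp], [x], [z].  The sum
    of the minorant inequality at [xp] and [b] times the one at [z] is the
    inequality at [y] up to [b <v, z - zp>], and this inner product is the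
    cross term of [|zp - b v - z|^2].  The inequality at [xp] carries its weight
    [t], so that it holds for every real [Fp] when [t = 0], where the objective may
    be infinite at [xp]. *)
Lemma accelerated_step (c b t e Fp Fx Fz : R) (v xp zp x y z : 'rV[R]_n) :
  0 <= b -> 0 < t + b -> b ^+ 2 = c * (t + b) ->
  y = (t / (t + b)) *: xp + (b / (t + b)) *: zp ->
  dotv v (x - y) + e <= - (c / 2 * dotv v v) ->
  t * (Fx + dotv v (xp - x) - e) <= t * Fp ->
  Fx + dotv v (z - x) - e <= Fz ->
  (t + b) * (Fx - Fz) + enorm (zp - b *: v - z) ^+ 2 / 2
    <= t * (Fp - Fz) + enorm (zp - z) ^+ 2 / 2.
Proof.
move=> b0 tb0 bE yE crit subp subz.
have y_mean : (t + b) * dotv v y = t * dotv v xp + b * dotv v zp.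
  by rewrite yE !dotv_expand; field; rewrite gt_eqF.
rewrite !sqr_enorm !dotv_expand !(dotvC _ v) (dotvC z zp).
move: crit subp subz; rewrite !dotv_expand.
rewrite -(ler_pM2l tb0) => crit subp /(ler_wpM2l b0) subz.
have bV : b ^+ 2 * dotv v v = c * (t + b) * dotv v v by rewrite bE.
lra.
Qed.

End Inexact.

(** * Growth of the step sizes *)

Section StepSizes.
Context {R : realType} (a s : R).
Hypotheses (a0 : 0 < a) (s1 : s ^+ 2 < 1).
Let c := a * (1 - s ^+ 2).

Let c0 : 0 < c. Proof. by rewrite mulr_gt0// subr_gt0. Qed.

Lemma apg_beta_gt0 t : 0 <= t -> 0 < apg_beta a s t.
Proof. by move=> t0; rewrite divr_gt0// ltr_wpDr// sqrtr_ge0. Qed.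

Lemma apg_beta_sqr t : 0 <= t ->
  apg_beta a s t ^+ 2 = c * (t + apg_beta a s t).
Proof.
move=> t0; rewrite /apg_beta; set d := _ + 4 * _ * _ * _.
have dE : d = c ^+ 2 + 4 * c * t by rewrite /d /c; ring.
have d0 : 0 <= d.
  rewrite dE; have := mulr_ge0 (ltW c0) t0; have := sqr_ge0 c; lra.
have : Num.sqrt d ^+ 2 = c ^+ 2 + 4 * c * t by rewrite sqr_sqrtr.
rewrite -/c; move: (Num.sqrt d) => r r2. lra.
Qed.

Lemma apg_beta_ge t k : 0 <= k -> c * k ^+ 2 / 4 <= t ->
  c * (k + 1) / 2 <= apg_beta a s t.
Proof.
move=> k0 tk; rewrite ler_pM2r ?invr_gt0// -/c mulrDr mulr1 addrC lerD2l.
rewrite -[leLHS]ger0_norm; last exact: mulr_ge0 (ltW c0) k0.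
rewrite -sqrtr_sqr ler_wsqrtr//.
have := ler_wpM2l (ltW c0) tk.
have := sqr_ge0 c; rewrite /c; lra.
Qed.

(** The recursion gives [t (k+1) >= t k + c / 2 + sqrt (c * t k)], which is at
    least [(sqrt (t k) + sqrt c / 2)^2]: the square root of [t] increases by
    [sqrt c / 2] or more at each step. *)
Lemma apg_t_ge k : c * k%:R ^+ 2 / 4 <= apg_t a s k.
Proof.
elim: k => [|k IH] /=; first by rewrite expr0n mulr0 mul0r.
have := apg_beta_ge (ler0n _ k) IH.
by rewrite -[k.+1%:R]natr1; have := c0; lra.
Qed.

Lemma apg_t_ge0 k : 0 <= apg_t a s k.
Proof.
apply: le_trans (apg_t_ge k).
by rewrite divr_ge0// mulr_ge0 ?sqr_ge0// ltW.
Qed.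

End StepSizes.

(** * The convergence rate *)

Section Convergence.
Context {R : realType} {n : nat} (f : 'rV[R]_n -> R) (g : 'rV[R]_n -> \bar R).
Context (L sigma : R) (x xbar w : nat -> 'rV[R]_n) (eps : nat -> R).
Hypotheses (f_convex : convex_function setT f)
  (f_diff : forall z, differentiable f z) (L_gt0 : 0 < L)
  (grad_lip : forall y z, enorm (grad f y - grad f z) <= L * enorm (y - z))
  (g_gtNy : forall z, (g z != -oo)%E)
  (sigma_itv : 0 < sigma ^+ 2 < 1 / 2)
  (run : inexact_apg f g L sigma x xbar w eps).
Let F := csum f g.
Let alpha := sigma ^+ 2 / L.
Let t := apg_t alpha sigma.

Let alpha_gt0 : 0 < alpha.
Proof. by case/andP: sigma_itv => ? _; rewrite divr_gt0. Qed.

Let sigma_lt1 : sigma ^+ 2 < 1.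
Proof. by case/andP: sigma_itv => _ ?; lra. Qed.

Lemma csum_gtNy z : (F z != -oo)%E.
Proof. by rewrite /F/csum; case: (g z) (g_gtNy z). Qed.

Lemma csum_fin_num z : (F z < +oo)%E -> F z \is a fin_num.
Proof. by move: (csum_gtNy z); case: (F z). Qed.

(** Having an approximate subgradient at [xbar k] forces finiteness there as soon
    as the objective is finite somewhere. *)
Lemma csum_iterate_fin_num k z :
  (0 < k)%N -> (F z < +oo)%E -> F (xbar k) \is a fin_num.
Proof.
case: k => // k _; have [_ sub _ _] := run k.
move: sub => /(eps_subdiff_csum 0 L_gt0 f_diff grad_lip f_convex (g_gtNy _)).
by move=> /eps_subdiff_fin_num; apply; exact: csum_gtNy.
Qed.

Lemma apg_potential z k : (F z < +oo)%E ->
  t k * (fine (F (xbar k)) - fine (F z)) + enorm (x k - z) ^+ 2 / 2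
    <= enorm (x 0%N - z) ^+ 2 / 2.
Proof.
move=> Fz; elim: k => [|k IH]; first by rewrite mul0r add0r.
apply: le_trans IH; rewrite /t/= -/t.
have [_] := run k; rewrite -/alpha -/t; set y := (_ *: xbar k + _).
move=> sub crit ->; rewrite -/t.
have t0 : 0 <= t k := apg_t_ge0 alpha_gt0 sigma_lt1 k.
have b0 := apg_beta_gt0 alpha_gt0 sigma_lt1 t0.
have Fsub := eps_subdiff_csum y L_gt0 f_diff grad_lip f_convex (g_gtNy _) sub.
have Fx := csum_iterate_fin_num (ltn0Sn k) Fz.
have fine_sub u : (F u < +oo)%E -> fine (F (xbar k.+1))
    + dotv (grad f y + w k.+1) (u - xbar k.+1)
    - (eps k.+1 + L / 2 * enorm (xbar k.+1 - y) ^+ 2) <= fine (F u).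
  move=> Fu; rewrite -lee_fin (fineK (csum_fin_num Fu)) EFinB EFinD (fineK Fx).
  exact: Fsub.
apply: accelerated_step (inexact_prox_criterion (L := L) _ _ _ crit) _ _ => //.
- exact: ltW.
- by rewrite ltr_wpDl.
- by rewrite (apg_beta_sqr alpha_gt0 sigma_lt1 t0).
- by rewrite /alpha divfK// gt_eqF.
- by case/andP: sigma_itv => _ /ltW.
- (* [F] may be infinite at the arbitrary point [xbar 0], but [t 0 = 0] *)
  case: (posnP k) => [k0|k_gt0].
    by have -> : t k = 0 by [rewrite k0]; rewrite !mul0r.
  apply: ler_wpM2l => //; apply: fine_sub.
  by rewrite ltey_eq (csum_iterate_fin_num k_gt0 Fz).
- exact: fine_sub.
Qed.

End Convergence.

Theorem corollary2 (R : realType) (n : nat)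
    (f : 'rV[R]_n -> R) (g : 'rV[R]_n -> \bar R) (L sigma : R)
    (x xbar w : nat -> 'rV[R]_n) (eps : nat -> R)
    (f_convex : convex_function setT f)
    (f_diff : forall z, differentiable f z)
    (L_gt0 : 0 < L)
    (grad_lip : forall y z, enorm (grad f y - grad f z) <= L * enorm (y - z))
    (g_pcc : proper_closed_convex g)
    (sigma_ge0 : 0 <= sigma)
    (sigma_itv : 0 < sigma ^+ 2 < 1 / 2)
    (run : inexact_apg f g L sigma x xbar w eps)
    (min_exists : minimizers (csum f g) !=set0) :
  let sstar := ereal_inf (range (csum f g)) in
  let d0 := edist_set (x 0%N) (minimizers (csum f g)) in
  forall k : nat, (1 <= k)%N ->
    (csum f g (xbar k) - sstar
      <= (2 * L * d0 ^+ 2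
          / (sigma ^+ 4 * (1 - sigma ^+ 2) * k%:R ^+ 2))%:E)%E.
Proof.
move=> sstar d0 [//|k] _.
have [[g_gtNy [u gu]] _ _] := g_pcc.
have [s0 s2] := andP sigma_itv.
have s1 : 0 < 1 - sigma ^+ 2 by lra.
set F := csum f g; set alpha := sigma ^+ 2 / L.
have alpha0 : 0 < alpha by exact: divr_gt0.
have Fu : (F u < +oo)%E.
  by rewrite /F/csum; case: (g u) gu (g_gtNy u) => // r _ _; rewrite -EFinD ltry.
have min_lty z : minimizers F z -> (F z < +oo)%E by move=> /(_ u)/le_lt_trans; exact.
have sstarE z : minimizers F z -> sstar = F z.
  move=> zmin; apply/eqP; rewrite eq_le ereal_inf_lbound/=; last by exists z.
  by apply/ereal_infP => _ [v _ <-]; exact: zmin.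
have [z0 z0min] := min_exists.
have Fk : F (xbar k.+1) \is a fin_num :=
  csum_iterate_fin_num f_convex f_diff L_gt0 grad_lip g_gtNy run (ltn0Sn k) Fu.
have Fz0 : F z0 \is a fin_num by apply: csum_fin_num => //; exact: min_lty.
rewrite (sstarE _ z0min) -(fineK Fk) -(fineK Fz0) -EFinB lee_fin.
set gap := _ - _.
have gap0 : 0 <= gap by rewrite subr_ge0 fine_le.
have gap_le z : minimizers F z ->
    2 * apg_t alpha sigma k.+1 * gap <= enorm (x 0%N - z) ^+ 2.
  move=> zmin.
  have := apg_potential f_convex f_diff L_gt0 grad_lip g_gtNy sigma_itv run
    k.+1 (min_lty z zmin).
  rewrite -/F -(sstarE _ zmin) (sstarE _ z0min) -/gap -/alpha.
  have := sqr_ge0 (enorm (x k.+1 - z)); lra.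
have t0 : 0 <= apg_t alpha sigma k.+1 by apply: apg_t_ge0 => //; lra.
have prod0 : 0 <= 2 * apg_t alpha sigma k.+1 * gap by rewrite !mulr_ge0.
have d0_ge : Num.sqrt (2 * apg_t alpha sigma k.+1 * gap) <= d0.
  apply: lb_le_inf; first by exists (enorm (x 0%N - z0)), z0.
  move=> _ [z zmin <-]; rewrite -[leRHS]ger0_norm ?sqrtr_ge0// -sqrtr_sqr.
  by rewrite ler_wsqrtr// gap_le.
have gap_d0 : 2 * apg_t alpha sigma k.+1 * gap <= d0 ^+ 2.
  rewrite -(sqr_sqrtr prod0) lerXn2r// nnegrE ?sqrtr_ge0//.
  exact: le_trans (sqrtr_ge0 _) d0_ge.
have s_lt1 : sigma ^+ 2 < 1 by lra.
have := ler_wpM2r gap0 (apg_t_ge alpha0 s_lt1 k.+1).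
have -> : sigma ^+ 4 = sigma ^+ 2 * sigma ^+ 2 by rewrite -exprD.
rewrite ler_pdivlMr; last first.
  exact: mulr_gt0 (mulr_gt0 (mulr_gt0 s0 s0) s1) (exprn_gt0 2 (ltr0Sn _ k)).
set N : R := k.+1%:R => growth.
have main : sigma ^+ 2 * (1 - sigma ^+ 2) * N ^+ 2 * gap <= 2 * L * d0 ^+ 2.
  have Lalpha : L * alpha = sigma ^+ 2 by rewrite mulrC divfK// gt_eqF.
  have aX : alpha * ((1 - sigma ^+ 2) * N ^+ 2 * gap) <= 2 * d0 ^+ 2 by lra.
  by have := ler_wpM2l (ltW L_gt0) aX; rewrite mulrA Lalpha; lra.
have main0 : 0 <= sigma ^+ 2 * (1 - sigma ^+ 2) * N ^+ 2 * gap.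
  exact: mulr_ge0 (mulr_ge0 (mulr_ge0 (ltW s0) (ltW s1)) (sqr_ge0 N)) gap0.
(* [main] has [sigma ^+ 2] where the claim has [sigma ^+ 4], which is smaller *)
by have := ler_wpM2r main0 (ltW s_lt1); lra.
Qed.
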